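(* Let $\Gamma$ be a group, $R$ a $\Gamma$-graded ring, $\gamma\in C_\Gamma(\Gamma_R)$, and $\delta\in\mathrm{Der}_\gamma(R)$. Then $R[t;\delta]$ is gr-prime if and only if $R$ is $\delta$-gr-prime.
   Context: Rings are associative with identity; $\Gamma$ is a (not necessarily abelian) group with identity $e$. A ring $R$ is $\Gamma$-graded if $R=\bigoplus_{\sigma\in\Gamma}R_\sigma$ with $R_\sigma R_\tau\subseteq R_{\sigma\tau}$ and $1_R\in R_e$; its support is $\Gamma_R=\{\sigma:R_\sigma\neq0\}$, and $C_\Gamma(\Gamma_R)$ is the centralizer of $\Gamma_R$ in $\Gamma$. $\mathrm{Der}_\gamma(R)$ is the set of additive maps $\delta:R\to R$ with $\delta(xy)=\delta(x)y+x\delta(y)$ and $\delta(R_\tau)\subseteq R_{\tau\gamma}$ for all $\tau\in\Gamma_R$. $R[t;\delta]$ is the free left $R$-module on $\{t^k\}_{k\ge0}$ with multiplication determined by $tx=xt+\delta(x)$, graded by $R[t;\delta]_\tau=\bigoplus_{i\ge0}R_{\tau\gamma^{-i}}t^i$. Ideals are two-sided; an ideal $\mathfrak a$ is graded if it contains the homogeneous components of each of its elements, and $\delta$-invariant if $\delta(\mathfrak a)\subseteq\mathfrak a$. A graded ring $A$ is gr-prime if for homogeneous $x,y\in A$, $xAy=0$ forces $x=0$ or $y=0$ (equivalently, $\mathfrak a\mathfrak b=0$ for graded ideals $\mathfrak a,\mathfrak b$ forces $\mathfrak a=0$ or $\mathfrak b=0$). $R$ is $\delta$-gr-prime if $\mathfrak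 a\mathfrak b=0$ for $\delta$-invariant graded ideals $\mathfrak a,\mathfrak b$ of $R$ forces $\mathfrak a=0$ or $\mathfrak b=0$. *)

(* Defs.v *)
From HB Require Import structures.
From mathcomp Require Import all_boot all_algebra.
From mathcomp Require Import finmap.
From mathcomp Require Import classical_sets.
From mathcomp Require Import monalg.

Set Implicit Arguments.
Unset Strict Implicit.
Unset Printing Implicit Defensive.

Import GRing.Theory.

Local Open Scope classical_set_scope.
Local Open Scope ring_scope.

Section Grading.
Variables (Gamma : groupType) (R : pzRingType).
Implicit Types (C : Gamma -> set R) (a b : set R).

Definition decomposes C (x : R) (s : seq Gamma) (f : Gamma -> R) :=
  [/\ uniq s, forall sigma, C sigma (f sigma) & x = \sum_(sigma <- s) f sigma].

Record grading := Grading {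
  gr_comp :> Gamma -> set R;
  gr_comp0 : forall sigma, gr_comp sigma 0;
  gr_compB : forall sigma x y,
    gr_comp sigma x -> gr_comp sigma y -> gr_comp sigma (x - y);
  gr_spanning : forall x, exists s f, decomposes gr_comp x s f;
  gr_direct : forall s f, decomposes gr_comp 0 s f ->
    forall sigma, sigma \in s -> f sigma = 0;
  gr_comp1 : gr_comp 1%g 1;
  gr_compM : forall sigma tau x y,
    gr_comp sigma x -> gr_comp tau y -> gr_comp (sigma * tau)%g (x * y)
}.

Implicit Type G : grading.

Definition gr_support G : set Gamma := [set sigma | G sigma <> [set 0]].

Definition homogeneous G (x : R) := exists sigma, G sigma x.

Definition homogeneous_component G (x : R) (sigma : Gamma) (y : R) :=
  exists s f, [/\ decomposes G x s f, sigma \in s & y = f sigma].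

Definition ideal a :=
  [/\ a 0, forall x y, a x -> a y -> a (x - y)
    & forall r x, a x -> a (r * x) /\ a (x * r)].

Definition ideal_prod a b : set R :=
  [set z | exists s : seq (R * R),
     (forall u, u \in s -> a u.1 /\ b u.2) /\ z = \sum_(u <- s) u.1 * u.2].

Definition graded_ideal G a :=
  ideal a /\
  forall x, a x -> forall sigma y, homogeneous_component G x sigma y -> a y.

Definition gr_prime G :=
  forall x y : R, homogeneous G x -> homogeneous G y ->
    (forall r, x * r * y = 0) -> x = 0 \/ y = 0.

End Grading.

Definition centralizer (Gamma : groupType) (S : set Gamma) : set Gamma :=
  [set g | forall s, S s -> commute g s].

Record derivation (R : pzRingType) := Derivation {
  der_fun :> {additive R -> R};
  derM : forall x y, der_fun (x * y) = der_fun x * y + x * der_fun y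
}.

Definition Der (Gamma : groupType) (R : pzRingType) (G : grading Gamma R)
    (gamma : Gamma) : set (derivation R) :=
  [set delta | forall tau, gr_support G tau ->
     forall x, G tau x -> G (tau * gamma)%g (delta x)].

Definition invariant_set (R : pzRingType) (delta : derivation R) (a : set R) :=
  delta @` a `<=` a.

Definition delta_gr_prime (Gamma : groupType) (R : pzRingType)
    (G : grading Gamma R) (delta : derivation R) :=
  forall a b : set R,
    graded_ideal G a -> invariant_set delta a ->
    graded_ideal G b -> invariant_set delta b ->
    ideal_prod a b = [set 0] -> a = [set 0] \/ b = [set 0].

(* R[t; delta]: the element p of {malg R[nat]} stands for
   \sum_k p@_k t^k, coefficients on the left; {poly R} is not used because
   it requires R to be nontrivial. *)
Definition skewpoly (R : pzRingType) (delta : derivation R) : Type :=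
  {malg R[nat]}.

HB.instance Definition _ (R : pzRingType) (delta : derivation R) :=
  GRing.Zmodule.copy (skewpoly delta) {malg R[nat]}.

Section SkewPoly.
Variables (R : pzRingType) (delta : derivation R).
Local Notation S := (skewpoly delta).
Implicit Types (p q r : S) (x y : R).

Definition skewC x : S := << x *g 0%N >>.
Definition skewt : S := << 1 *g 1%N >>.

Definition skew_scale x p : S := \sum_(k <- msupp p) << x * p@_k *g k >>.

(* left multiplication by t: t (a t^k) = a t^(k+1) + delta(a) t^k *)
Definition skew_lt p : S :=
  \sum_(k <- msupp p) (<< p@_k *g k.+1 >> + << delta p@_k *g k >>).

Definition skew_mul p q : S :=
  \sum_(k <- msupp p) skew_scale p@_k (iter k skew_lt q).

Lemma skewP p q : (forall k, p@_k = q@_k) -> p = q.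
Proof. by move/malgP. Qed.

Lemma skew_coefD p q k : (p + q)@_k = p@_k + q@_k.
Proof. exact: mcoeffD. Qed.

Lemma skew_coef0 k : (0 : S)@_k = 0.
Proof. exact: mcoeff0. Qed.

Lemma skew_coefN p k : (- p)@_k = - p@_k.
Proof. exact: mcoeffN. Qed.

Lemma skew_coef_sum (I : Type) (s : seq I) (F : I -> S) k :
  (\sum_(i <- s) F i)@_k = \sum_(i <- s) (F i)@_k.
Proof. exact: (raddf_sum (mcoeff k)). Qed.

Lemma skew_sum1 (F : nat -> R) p k : (F k != 0 -> k \in msupp p) ->
  \sum_(i <- msupp p) F i *+ (i == k) = F k.
Proof.
move=> Fk; case: (boolP (k \in msupp p)) => [kp|kp].
  rewrite (big_rem k) //= eqxx big1_seq ?addr0 // => i /andP[_].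
  by rewrite mem_rem_uniq ?fset_uniq // inE => /andP[/negPf->].
have -> : F k = 0 by apply/eqP; apply: contraR kp.
rewrite big1_seq // => i /andP[_ ip]; case: eqP => // ik.
by rewrite -ik ip in kp.
Qed.

Lemma skew_scaleE x p k : (skew_scale x p)@_k = x * p@_k.
Proof.
rewrite skew_coef_sum -(@skew_sum1 (fun i => x * p@_i) p k).
  by apply: eq_bigr => i _; rewrite mcoeffU.
by rewrite -mcoeff_neq0; apply: contraNneq => ->; rewrite mulr0.
Qed.

Lemma skew_ltE p k :
  (skew_lt p)@_k = (if k is j.+1 then p@_j else 0) + delta p@_k.
Proof.
rewrite skew_coef_sum.
transitivity (\sum_(i <- msupp p) p@_i *+ (i.+1 == k) +
              \sum_(i <- msupp p) delta p@_i *+ (i == k)).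
  by rewrite -big_split; apply: eq_bigr => i _; rewrite mcoeffD !mcoeffU.
congr (_ + _).
  case: k => [|j]; first by rewrite big1.
  rewrite -[RHS](@skew_sum1 (fun i => p@_i) p j) //.
  by rewrite -mcoeff_neq0.
apply: (@skew_sum1 (fun i => delta p@_i)).
by rewrite -mcoeff_neq0; apply: contraNneq => ->; rewrite raddf0.
Qed.

Fact skew_scaleA x y p : skew_scale x (skew_scale y p) = skew_scale (x * y) p.
Proof. by apply: skewP => k; rewrite !skew_scaleE mulrA. Qed.
Fact skew_scale1 : left_id 1 skew_scale.
Proof. by move=> p; apply: skewP => k; rewrite skew_scaleE mul1r. Qed.
Fact skew_scaleDr : right_distributive skew_scale +%R.
Proof.
by move=> x p q; apply: skewP => k; rewrite !(skew_coefD, skew_scaleE) mulrDr.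
Qed.
Fact skew_scaleDl p : {morph skew_scale^~ p : x y / x + y}.
Proof.
by move=> x y; apply: skewP => k; rewrite !(skew_coefD, skew_scaleE) mulrDl.
Qed.

HB.instance Definition _ := GRing.Zmodule_isLmodule.Build R S
  skew_scaleA skew_scale1 skew_scaleDr skew_scaleDl.

Lemma skew_coefZ x p k : (x *: p)@_k = x * p@_k.
Proof. exact: skew_scaleE. Qed.

Lemma skew_scaleZ x p : skew_scale x p = x *: p.
Proof. by []. Qed.

Fact skew_lt_additive : zmod_morphism skew_lt.
Proof.
move=> p q; apply: skewP => k.
rewrite !(skew_coefD, skew_coefN, skew_ltE) raddfB.
by case: k => [|k]; rewrite ?sub0r ?add0r // skew_coefD skew_coefN opprD addrACA.
Qed.
HB.instance Definition _ :=
  GRing.isZmodMorphism.Build S S skew_lt skew_lt_additive.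

Fact skew_iter_additive n : zmod_morphism (iter n skew_lt).
Proof.
by elim: n => // n IH p q; rewrite !iterS IH raddfB.
Qed.
HB.instance Definition _ n :=
  GRing.isZmodMorphism.Build S S (iter n skew_lt) (skew_iter_additive n).

Lemma skew_ltZ x p : skew_lt (x *: p) = x *: skew_lt p + delta x *: p.
Proof.
apply: skewP => k; rewrite !(skew_coefD, skew_coefZ, skew_ltE) derM mulrDr.
case: k => [|k]; rewrite ?skew_coefZ; first by rewrite mulr0 !add0r addrC.
by rewrite -!addrA [delta _ * _ + _]addrC.
Qed.

Lemma skew_mulEw p q n : (forall k, k \in msupp p -> k < n)%N ->
  skew_mul p q = \sum_(0 <= k < n) p@_k *: iter k skew_lt q.
Proof.
move=> pn; rewrite /skew_mul.
rewrite [RHS](bigID (mem (msupp p))) /= [X in _ + X]big1 ?addr0; last first.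
  by move=> k kp; rewrite mcoeff_outdom // scale0r.
rewrite -[RHS]big_filter; apply: perm_big; apply: uniq_perm.
- exact: fset_uniq.
- by rewrite filter_uniq // iota_uniq.
move=> k; rewrite mem_filter mem_index_iota /=.
by case: (boolP (k \in msupp p)) => // /pn ->.
Qed.

Definition skew_bound p : nat := (\max_(k <- msupp p) k).+1.
Lemma skew_boundP p k : k \in msupp p -> (k < skew_bound p)%N.
Proof. by move=> kp; rewrite ltnS (big_rem k) //= leq_maxl. Qed.

Lemma skew_common p q : exists n,
  (forall k, k \in msupp p -> k < n)%N /\ (forall k, k \in msupp q -> k < n)%N.
Proof.
exists (skew_bound p + skew_bound q)%N; split=> k /skew_boundP kb.
  exact: leq_trans (leq_addr _ _).
exact: leq_trans (leq_addl _ _).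
Qed.

Fact skew_mulBl p q r : skew_mul (p - q) r = skew_mul p r - skew_mul q r.
Proof.
have [n [pn qn]] := skew_common p q.
rewrite (skew_mulEw _ pn) (skew_mulEw _ qn) (@skew_mulEw _ _ n).
  rewrite -sumrB; apply: eq_bigr => k _.
  by rewrite skew_coefD skew_coefN scalerBl.
move=> k; rewrite -mcoeff_neq0 skew_coefD skew_coefN => nz.
case: (boolP (k \in msupp p)) => [/pn //|kp]; apply: qn.
apply: contraNT nz => kq.
by rewrite (mcoeff_outdom kp) (mcoeff_outdom kq) subrr.
Qed.

Fact skew_mulBr p q r : skew_mul p (q - r) = skew_mul p q - skew_mul p r.
Proof.
rewrite /skew_mul -sumrB; apply: eq_bigr => k _.
by rewrite raddfB !skew_scaleZ scalerBr.
Qed.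

HB.instance Definition _ p :=
  GRing.isZmodMorphism.Build S S (skew_mul p) (skew_mulBr p).

Fact skew_mulDl : left_distributive skew_mul +%R.
Proof.
move=> p q r; apply/eqP.
by rewrite -subr_eq -skew_mulBl addrK.
Qed.
Lemma skew_mul_suml (I : Type) (s : seq I) (F : I -> S) r :
  skew_mul (\sum_(i <- s) F i) r = \sum_(i <- s) skew_mul (F i) r.
Proof.
have m0 : skew_mul 0 r = 0 by have := skew_mulBl 0 0 r; rewrite !subrr.
elim: s => [|i s IH]; first by rewrite !big_nil.
by rewrite !big_cons skew_mulDl IH.
Qed.
Fact skew_mulDr : right_distributive skew_mul +%R.
Proof. by move=> p q r; apply: raddfD. Qed.

Lemma skew_mulZl x p q : skew_mul (x *: p) q = x *: skew_mul p q.
Proof.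
rewrite (skew_mulEw _ (@skew_boundP p)) (@skew_mulEw _ _ (skew_bound p)).
  by rewrite scaler_sumr; apply: eq_bigr => k _; rewrite skew_coefZ scalerA.
move=> k; rewrite -mcoeff_neq0 skew_coefZ => nz; apply: skew_boundP.
by rewrite -mcoeff_neq0; apply: contraNneq nz => ->; rewrite mulr0.
Qed.

Lemma skew_mulU x k q : skew_mul << x *g k >> q = x *: iter k skew_lt q.
Proof.
rewrite (@skew_mulEw _ _ k.+1); last first.
  move=> i; rewrite -mcoeff_neq0 mcoeffU.
  by case: (k =P i) => [-> //|_]; rewrite eqxx.
rewrite big_nat_recr //= mcoeffU eqxx mulr1n big_nat big1 ?add0r // => i ik.
by rewrite mcoeffU gtn_eqF ?scale0r.
Qed.

Lemma skew_lt_mul p q : skew_mul (skew_lt p) q = skew_lt (skew_mul p q).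
Proof.
rewrite {1}/skew_lt skew_mul_suml [in RHS]/skew_mul raddf_sum.
apply: eq_bigr => k _ /=.
by rewrite skew_mulDl !skew_mulU skew_scaleZ skew_ltZ.
Qed.

Fact skew_mulA : associative skew_mul.
Proof.
move=> p q r; have mulE p1 p2 : skew_mul p1 p2 =
  \sum_(k <- msupp p1) skew_scale p1@_k (iter k skew_lt p2) by [].
rewrite [LHS]mulE [skew_mul p q]mulE skew_mul_suml; apply: eq_bigr => k _.
rewrite !skew_scaleZ skew_mulZl; congr (_ *: _).
by elim: (k : nat) => //= n ->; rewrite skew_lt_mul.
Qed.

Fact skew_mul1l : left_id (skewC 1) skew_mul.
Proof. by move=> p; rewrite skew_mulU scale1r. Qed.

Lemma skew_ltU k : skew_lt << 1 *g k >> = << 1 *g k.+1 >>.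
Proof.
have d1 : delta 1 = 0.
  have := derM delta 1 1; rewrite !mulr1 mul1r => /eqP.
  by rewrite -subr_eq subrr => /eqP.
apply: skewP => i; rewrite skew_ltE !mcoeffU raddfMn d1 mul0rn addr0.
by case: i => // i; rewrite mcoeffU.
Qed.

Lemma skew_iter1 k : iter k skew_lt (skewC 1) = << 1 *g k >>.
Proof. by elim: k => //= k ->; rewrite skew_ltU. Qed.

Fact skew_mul1r : right_id (skewC 1) skew_mul.
Proof.
move=> p; rewrite /skew_mul [RHS]monalgE; apply: eq_bigr => k _.
rewrite skew_iter1; apply: skewP => i.
by rewrite skew_scaleE !mcoeffU mulrnAr mulr1.
Qed.

HB.instance Definition _ := GRing.Zmodule_isPzRing.Build S
  skew_mulA skew_mul1l skew_mul1r skew_mulDl skew_mulDr.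

Lemma skewt_exp k : skewt ^+ k = << 1 *g k >>.
Proof.
elim: k => // k IH; rewrite exprS IH.
by rewrite -[_ * _]/(skew_mul _ _) skew_mulU /= scale1r skew_ltU.
Qed.

Lemma skewC_scale x p : skewC x * p = x *: p.
Proof. exact: skew_mulU. Qed.

Lemma skew_basis p : p = \sum_(k <- msupp p) p@_k *: skewt ^+ k.
Proof.
rewrite {1}[p]monalgE; apply: eq_bigr => k _; rewrite skewt_exp.
apply: skewP => i.
by rewrite skew_coefZ !mcoeffU mulrnAr mulr1.
Qed.

Lemma skew_tx x : skewt * skewC x = skewC x * skewt + skewC (delta x).
Proof.
rewrite skewC_scale -[LHS]/(skew_mul _ _) skew_mulU /= scale1r.
apply: skewP => i; rewrite skew_ltE skew_coefD skew_coefZ !mcoeffU.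
case: i => [|[|i]]; rewrite /= ?mcoeffU /= ?mulr0n ?mulr0 ?mulr1n ?mulr1 //.
- by rewrite raddf0.
- by rewrite raddf0.
Qed.

End SkewPoly.

Section SkewGrading.
Variables (Gamma : groupType) (R : pzRingType) (G : grading Gamma R).
Variables (gamma : Gamma) (delta : derivation R).
Hypothesis gammaC : centralizer (gr_support G) gamma.
Hypothesis deltaD : Der G gamma delta.
Local Notation S := (skewpoly delta).
Implicit Types (p q : S).

Definition skew_comp (tau : Gamma) : set S :=
  [set p | forall i, G (tau * gamma ^- i)%g p@_i].

Lemma gr_compN sigma x : G sigma x -> G sigma (- x).
Proof. by move=> Gx; rewrite -sub0r; apply: gr_compB (gr_comp0 _ _) Gx. Qed.
Lemma gr_compD sigma x y : G sigma x -> G sigma y -> G sigma (x + y).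
Proof. by move=> Gx Gy; rewrite -[y]opprK; apply/gr_compB/gr_compN. Qed.

Lemma gr_supportP sigma x : G sigma x -> x != 0 -> gr_support G sigma.
Proof.
by move=> Gx /eqP x0 e; move: Gx; rewrite e.
Qed.

Fact skew_comp0 tau : skew_comp tau 0.
Proof. by move=> i; rewrite skew_coef0; apply: gr_comp0. Qed.
Fact skew_compB tau p q :
  skew_comp tau p -> skew_comp tau q -> skew_comp tau (p - q).
Proof.
move=> Cp Cq i; rewrite skew_coefD skew_coefN.
exact: gr_compB (Cp i) (Cq i).
Qed.
Lemma skew_compD tau p q :
  skew_comp tau p -> skew_comp tau q -> skew_comp tau (p + q).
Proof.
by move=> Cp Cq i; rewrite skew_coefD; apply: gr_compD (Cp i) (Cq i).
Qed.

Lemma decomposable_sum (I : Type) (s : seq I) (F : I -> S) :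
  (forall i, exists u f, decomposes skew_comp (F i) u f) ->
  exists u f, decomposes skew_comp (\sum_(i <- s) F i) u f.
Proof.
move=> dF; elim: s => [|i s [u [f [uu Cf e]]]].
  exists [::], (fun=> 0); split=> //; first by move=> ?; apply: skew_comp0.
  by rewrite !big_nil.
have [v [g [uv Cg e']]] := dF i; rewrite big_cons e e'.
pose F1 sigma := if sigma \in v then g sigma else 0.
pose F2 sigma := if sigma \in u then f sigma else 0.
exists (undup (v ++ u)), (fun sigma => F1 sigma + F2 sigma).
have sub (w : seq Gamma) (h : Gamma -> S) : uniq w ->
    {subset w <= undup (v ++ u)} ->
    \sum_(sigma <- undup (v ++ u)) (if sigma \in w then h sigma else 0)
    = \sum_(sigma <- w) h sigma.
  move=> uw ws; rewrite -big_mkcond -big_filter; apply: perm_big.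
  apply: uniq_perm => //; first by rewrite filter_uniq ?undup_uniq.
  by move=> sigma; rewrite mem_filter; case: (boolP (_ \in w)) => // /ws ->.
split; first exact: undup_uniq.
  by move=> sigma; apply: skew_compD; rewrite /F1 /F2;
    case: ifP => // _; apply: skew_comp0.
rewrite big_split /F1 /F2 !sub // => sigma;
  by rewrite mem_undup mem_cat => ->; rewrite ?orbT.
Qed.

Fact skew_spanning p : exists s f, decomposes skew_comp p s f.
Proof.
rewrite [p]monalgE; apply: decomposable_sum => k.
have [s [f [us Gf ->]]] := gr_spanning G p@_k.
exists [seq (sigma * gamma ^+ k)%g | sigma <- s],
       (fun tau => << f (tau * gamma ^- k)%g *g k >>); split.
- by rewrite map_inj_uniq //; apply: mulIg.
- move=> tau i; rewrite mcoeffU; case: eqP => [<-|_]; first exact: Gf.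
  exact: gr_comp0.
rewrite big_map; apply: skewP => i.
rewrite skew_coef_sum mcoeffU -sumrMnl; apply: eq_bigr => sigma _.
by rewrite mcoeffU mulgK.
Qed.

Fact skew_direct s f : decomposes skew_comp 0 s f ->
  forall tau, tau \in s -> f tau = 0.
Proof.
case=> us Cf e tau taus; apply: skewP => i; rewrite skew_coef0.
have := @gr_direct _ _ G [seq (sigma * gamma ^- i)%g | sigma <- s]
  (fun sigma => (f (sigma * gamma ^+ i)%g)@_i).
move=> /(_ _ (tau * gamma ^- i)%g); rewrite mulgVK; apply; last exact: map_f.
split; first by rewrite map_inj_uniq //; apply: mulIg.
  by move=> sigma; have := Cf (sigma * gamma ^+ i)%g i; rewrite mulgK.
rewrite big_map -[LHS](skew_coef0 delta i) e skew_coef_sum.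
by apply: eq_bigr => sigma _; rewrite mulgVK.
Qed.

Fact skew_comp1 : skew_comp 1%g 1.
Proof.
move=> i; rewrite -[1]/(skewC delta 1) mcoeffU; case: eqP => [<-|_].
  by rewrite expg0 invg1 mulg1; apply: gr_comp1.
exact: gr_comp0.
Qed.

Lemma Der_comp tau x : G tau x -> G (tau * gamma)%g (delta x).
Proof.
move=> Gx; have [->|x0] := eqVneq x 0.
  by rewrite raddf0; apply: gr_comp0.
exact: deltaD (gr_supportP Gx x0) _ Gx.
Qed.

Lemma skew_comp_lt tau q :
  skew_comp tau q -> skew_comp (tau * gamma)%g (skew_lt q).
Proof.
move=> Cq i; rewrite skew_ltE; apply: gr_compD.
  case: i => [|i]; first exact: gr_comp0.
  have -> : (tau * gamma * gamma ^- i.+1 = tau * gamma ^- i)%g.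
    by rewrite expgSr invgM mulgA mulgK.
  exact: Cq.
have -> : (tau * gamma * gamma ^- i = tau * gamma ^- i * gamma)%g.
  rewrite -!mulgA; congr (tau * _)%g.
  by apply: commuteV; apply: commuteX; apply: commute_refl.
exact: Der_comp.
Qed.

Fact skew_compM sigma tau p q :
  skew_comp sigma p -> skew_comp tau q -> skew_comp (sigma * tau)%g (p * q).
Proof.
move=> Cp Cq; have [->|/eqP q0] := q =P 0; first by rewrite mulr0; apply: skew_comp0.
have tauC : commute gamma tau.
  have [j qj] : exists j, q@_j != 0.
    have : msupp q != fset0.
      apply: contraNneq q0 => eq0; apply/eqP/skewP => j.
      by rewrite skew_coef0 mcoeff_outdom // eq0 inE.
    by case/fset0Pn => j jq; exists j; rewrite mcoeff_neq0.
  rewrite -(mulgVK (gamma ^+ j)%g tau); apply: commuteM.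
    by apply: gammaC; apply: gr_supportP (Cq j) qj.
  by apply: commuteX; apply: commute_refl.
have Ciq k : skew_comp (tau * gamma ^+ k)%g (iter k (@skew_lt _ delta) q).
  elim: k => [|k IH]; first by rewrite expg0 mulg1.
  by rewrite expgSr mulgA iterS; apply: skew_comp_lt.
rewrite -[p * q]/(skew_mul p q) /skew_mul.
elim: (enum_fset (msupp p)) => [|k s IH]; first by rewrite big_nil; apply: skew_comp0.
rewrite big_cons; apply: skew_compD IH => i; rewrite skew_scaleE.
have -> : (sigma * tau * gamma ^- i =
           sigma * gamma ^- k * (tau * gamma ^+ k * gamma ^- i))%g.
  have /commuteX-/(_ k) c : commute tau gamma by exact: commute_sym.
  by rewrite c -!mulgA mulKg.
exact: gr_compM (Cp k) (Ciq k i).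
Qed.

Definition skew_grading : grading Gamma S :=
  Grading skew_comp0 skew_compB skew_spanning skew_direct skew_comp1 skew_compM.

End SkewGrading.

(* Main.v *)
Require Import Defs.
From HB Require Import structures.
From mathcomp Require Import all_boot all_algebra.
From mathcomp Require Import finmap boolp classical_sets monalg.

(** Both directions move graded ideals between [R] and [S = R[t; delta]].

    If [a], [b] are nonzero [delta]-invariant graded ideals of [R] with
    [a b = 0], pick nonzero homogeneous [x] in [a] and [y] in [b].  As [b] is
    [delta]-invariant, the polynomials with coefficients in [b] form a left
    ideal of [S] ([skew_mul_coef_in]), so [r y] has coefficients in [b] for
    every [r] in [S] and [x r y = 0]: [S] is not gr-prime.

    Conversely, let [x], [y] be nonzero homogeneous elements of [S] with
    [x S y = 0].  The left annihilator [I] of [S y] and the right annihilator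
    [J] of [I] are nonzero graded ideals of [S] with [I J = 0]
    ([left_annihilator_graded], [right_annihilator_graded]).  The leading
    coefficients of the elements of a graded ideal of [S] form a graded ideal
    of [R] ([leading_coefs_graded]), and this ideal is [delta]-invariant
    because taking the commutator with [t] applies [delta] to each coefficient
    ([skew_commutator_coef]).  The top coefficient of a product is the product
    of the top coefficients, so the leading coefficient ideals of [I] and [J]
    are nonzero with product zero: [R] is not [delta]-gr-prime.

    Gradings are handled through the additive projections [gcomp G sigma]
    onto the homogeneous components. *)

Set Implicit Arguments.
Unset Strict Implicit.
Unset Printing Implicit Defensive.

Import GRing.Theory.

Local Open Scope classical_set_scope.
Local Open Scope ring_scope.

(** * Projections onto homogeneous components *)

Section HomogeneousProjection.
Variables (Gamma : groupType) (R : pzRingType) (G : grading Gamma R).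
Implicit Types (sigma tau rho : Gamma) (x y : R) (s w : seq Gamma).

(** The relation [homogeneous_component] determines its last argument because
    the sum of the [G sigma] is direct ([decomposes_uniq]), so the choice made
    by [xget] is immaterial. *)
Definition gcomp sigma x : R :=
  xget 0 [set y | homogeneous_component G x sigma y].

Lemma sum_extend0 s w (f : Gamma -> R) : uniq s -> uniq w ->
  {subset s <= w} ->
  \sum_(sigma <- w) (if sigma \in s then f sigma else 0)
    = \sum_(sigma <- s) f sigma.
Proof.
move=> us uw sw; rewrite -big_mkcond -big_filter; apply: perm_big.
apply: uniq_perm => //; first by rewrite filter_uniq.
by move=> sigma; rewrite mem_filter; case: (boolP (_ \in s)) => // /sw ->.
Qed.

(** Two decompositions of [x], extended by zero to the union of their degrees,
    differ by a decomposition of [0]. *)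
Lemma decomposes_uniq x s f s' f' sigma :
  decomposes G x s f -> decomposes G x s' f' ->
  (if sigma \in s then f sigma else 0) =
  (if sigma \in s' then f' sigma else 0).
Proof.
case=> us Gf xf [us' Gf' xf']; set w := undup (s ++ s').
have uw : uniq w := undup_uniq _.
have sw : {subset s <= w} by move=> r; rewrite mem_undup mem_cat => ->.
have sw' : {subset s' <= w}.
  by move=> r; rewrite mem_undup mem_cat => ->; rewrite orbT.
have := @gr_direct _ _ G w (fun r => (if r \in s then f r else 0) -
                                     (if r \in s' then f' r else 0)).
have [rw|rw] := boolP (sigma \in w); last first.
  by rewrite !ifN //; apply: contra rw; [apply: sw' | apply: sw].
move=> /(_ _ _ rw) h; apply/eqP; rewrite -subr_eq0; apply/eqP/h; split=> //.
  by move=> r; apply: gr_compB; case: ifP => // _; apply: gr_comp0.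
by rewrite sumrB !sum_extend0 // -xf -xf' subrr.
Qed.

Lemma gcompE x s f sigma : decomposes G x s f ->
  gcomp sigma x = if sigma \in s then f sigma else 0.
Proof.
move=> df; rewrite /gcomp; case: xgetP => [y _ [s' [f' [df' ss' ->]]]|none].
  by rewrite (decomposes_uniq sigma df df') ss'.
by case: ifP => // ss; case: (none (f sigma)); exists s, f.
Qed.

Lemma gcomp_component x sigma y :
  homogeneous_component G x sigma y -> y = gcomp sigma x.
Proof. by case=> s [f [df ss ->]]; rewrite (gcompE _ df) ss. Qed.

Lemma gcomp_in sigma x : G sigma (gcomp sigma x).
Proof.
have [s [f df]] := gr_spanning G x; rewrite (gcompE _ df).
by case: ifP => _; [case: df | apply: gr_comp0].
Qed.

Lemma gcomp_sum_over x : exists s, forall w, uniq w -> {subset s <= w} ->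
  x = \sum_(sigma <- w) gcomp sigma x.
Proof.
have [s [f df]] := gr_spanning G x; exists s => w uw sw.
under eq_bigr => sigma _ do rewrite (gcompE _ df).
by case: df => us _ {1}->; rewrite sum_extend0.
Qed.

Lemma gcomp_sum x : exists s, x = \sum_(sigma <- s) gcomp sigma x.
Proof.
have [s h] := gcomp_sum_over x; exists (undup s).
by apply: h; [apply: undup_uniq | move=> r; rewrite mem_undup].
Qed.

Lemma gcomp_homog sigma tau x : G tau x ->
  gcomp sigma x = if sigma == tau then x else 0.
Proof.
move=> Gx; pose f r := if r == tau then x else 0.
rewrite (@gcompE x [:: tau] f); first by rewrite inE /f; case: eqP.
split=> //; last by rewrite big_seq1 /f eqxx.
by move=> r; rewrite /f; case: eqP => [->//|_]; apply: gr_comp0.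
Qed.

Fact gcomp_additive sigma : zmod_morphism (gcomp sigma).
Proof.
move=> x y; have [s hx] := gcomp_sum_over x; have [s' hy] := gcomp_sum_over y.
(* adding sigma to the common list of degrees avoids a case distinction *)
pose w := undup (sigma :: s ++ s'); have uw : uniq w := undup_uniq _.
rewrite (@gcompE _ w (fun r => gcomp r x - gcomp r y)).
  by rewrite mem_undup mem_head.
split=> //; first by move=> r; apply: gr_compB; apply: gcomp_in.
by rewrite sumrB -hx // -?hy // => r; rewrite mem_undup inE mem_cat => ->;
  rewrite !orbT.
Qed.
HB.instance Definition _ sigma :=
  GRing.isZmodMorphism.Build R R (gcomp sigma) (gcomp_additive sigma).

Lemma gcompMr sigma tau x y : G tau y ->
  gcomp (sigma * tau)%g (x * y) = gcomp sigma x * y.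
Proof.
move=> Gy; have [s ->] := gcomp_sum x.
rewrite mulr_suml !raddf_sum mulr_suml; apply: eq_bigr => rho _ /=.
have Gx := gcomp_in rho x.
rewrite (gcomp_homog _ (gr_compM Gx Gy)) (gcomp_homog _ Gx).
by rewrite (inj_eq (@mulIg _ tau)); case: eqP; rewrite ?mul0r.
Qed.

Lemma gcompMl sigma tau x y : G sigma x ->
  gcomp (sigma * tau)%g (x * y) = x * gcomp tau y.
Proof.
move=> Gx; have [s ->] := gcomp_sum y.
rewrite mulr_sumr !raddf_sum mulr_sumr; apply: eq_bigr => rho _ /=.
have Gy := gcomp_in rho y.
rewrite (gcomp_homog _ (gr_compM Gx Gy)) (gcomp_homog _ Gy).
by rewrite (inj_eq (@mulgI _ sigma)); case: eqP; rewrite ?mulr0.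
Qed.

(** * Graded ideals *)

Lemma idealD (a : set R) x y : ideal a -> a x -> a y -> a (x + y).
Proof.
case=> a0 aB _ ax ay; rewrite -[y]opprK; apply: (aB) => //.
by rewrite -sub0r; apply: aB.
Qed.

Lemma graded_ideal_gcomp (a : set R) sigma x :
  graded_ideal G a -> a x -> a (gcomp sigma x).
Proof.
case=> [[a0 _ _] ga] ax; rewrite /gcomp; case: xgetP => [y _|//].
exact: ga.
Qed.

Lemma gcomp_graded_ideal (a : set R) :
  ideal a -> (forall sigma x, a x -> a (gcomp sigma x)) -> graded_ideal G a.
Proof.
by move=> ia ga; split=> // x ax sigma y /gcomp_component ->; apply: ga.
Qed.

Lemma graded_ideal_neq0 (a : set R) : graded_ideal G a -> a <> [set 0] ->
  exists sigma x, [/\ a x, G sigma x & x <> 0].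
Proof.
move=> ga a0; apply: contrapT => none; apply: a0; apply/seteqP.
split=> x /=; last by move=> ->; case: ga => [[]].
move=> ax; have [s ->] := gcomp_sum x; apply: big1 => sigma _.
apply: contrapT => nz; apply: none; exists sigma, (gcomp sigma x).
by split=> //; [apply: graded_ideal_gcomp | apply: gcomp_in].
Qed.

Lemma ideal_prod_eq0 (a b : set R) : a 0 -> b 0 ->
  ideal_prod a b = [set 0] <-> forall x y, a x -> b y -> x * y = 0.
Proof.
move=> a0 b0; split=> [ab0 x y ax by_|ab0].
  have : ideal_prod a b (x * y).
    exists [:: (x, y)]; rewrite big_seq1; split=> // u.
    by rewrite inE => /eqP ->.
  by rewrite ab0.
apply/seteqP; split=> z /=; last by move=> ->; exists [::]; rewrite big_nil.
by case=> s [sab ->]; apply: big1_seq => u /= /sab[]; apply: ab0.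
Qed.

(** The annihilator of the left ideal [R y] rather than of [y], which makes it a
    two-sided ideal. *)
Definition left_annihilator (y : R) : set R :=
  [set x | forall r, x * r * y = 0].

Definition right_annihilator (a : set R) : set R :=
  [set y | forall x, a x -> x * y = 0].

(** For homogeneous [r], [gcomp sigma x * r * y] is a homogeneous component of
    [x * r * y]. *)
Lemma left_annihilator_graded y :
  homogeneous G y -> graded_ideal G (left_annihilator y).
Proof.
case=> tau Gy; apply: gcomp_graded_ideal.
  split=> [r|x x' hx hx' r|r x hx]; first by rewrite !mul0r.
    by rewrite !mulrBl hx hx' subrr.
  by split=> r'; [rewrite -!mulrA [x * _]mulrA hx mulr0 |
                  rewrite -[x * r * r']mulrA hx].
move=> sigma x hx r; have [s ->] := gcomp_sum r.
rewrite mulr_sumr mulr_suml; apply: big1 => rho _.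
by rewrite -(gcompMr _ _ (gcomp_in rho r)) -(gcompMr _ _ Gy) hx raddf0.
Qed.

Lemma right_annihilator_graded (a : set R) :
  graded_ideal G a -> graded_ideal G (right_annihilator a).
Proof.
move=> ga; have [[_ _ aM] _] := ga; apply: gcomp_graded_ideal.
  split=> [x _|y y' hy hy' x ax|r y hy]; first by rewrite mulr0.
    by rewrite mulrBr hy // hy' // subrr.
  split=> x ax; last by rewrite mulrA hy // mul0r.
  by rewrite mulrA hy //; case: (aM r x ax).
move=> sigma y hy x ax; have [s ->] := gcomp_sum x.
rewrite mulr_suml; apply: big1 => rho _.
rewrite -(gcompMl _ _ (gcomp_in rho x)) hy ?raddf0 //.
exact: graded_ideal_gcomp.
Qed.

End HomogeneousProjection.

(** * Coefficients of skew polynomials *)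

Section SkewCoefficients.
Variables (R : pzRingType) (delta : derivation R).
Local Notation S := (skewpoly delta).
Implicit Types (p q : S) (x y : R) (k m n : nat).

Definition deg_le n p := forall k, (n < k)%N -> p@_k = 0.

Lemma deg_leP p : exists n, deg_le n p.
Proof.
exists (skew_bound p) => k pk; apply: mcoeff_outdom; apply/negP => /skew_boundP.
by rewrite ltnNge (ltnW pk).
Qed.

(** Left multiplication by [t] shifts the coefficients up by one; the terms
    coming from [delta] stay below the new top degree. *)
Lemma deg_le_iter_lt m k q : deg_le m q ->
  deg_le (k + m) (iter k (@skew_lt _ delta) q) /\
  (iter k (@skew_lt _ delta) q)@_(k + m) = q@_m.
Proof.
move=> dq; elim: k => //= k [IHd IHc]; rewrite addSn.
split; last by rewrite skew_ltE /= IHc IHd // raddf0 addr0.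
by case=> // j kj; rewrite skew_ltE !IHd ?raddf0 ?addr0 // ltnW.
Qed.

Lemma deg_leM n m p q : deg_le n p -> deg_le m q ->
  deg_le (n + m) (p * q) /\ (p * q)@_(n + m) = p@_n * q@_m.
Proof.
move=> dp dq; rewrite -[p * q]/(skew_mul p q) (@skew_mulEw _ _ p q n.+1).
  split=> [i ni|].
    rewrite skew_coef_sum big_nat; apply: big1 => k /andP[_ kn].
    have [di _] := deg_le_iter_lt k dq.
    by rewrite skew_coefZ di ?mulr0 // (leq_ltn_trans _ ni) // leq_add2r.
  rewrite skew_coef_sum big_nat_recr //= big_nat big1 ?add0r => [|k /andP[_ kn]].
    by rewrite skew_coefZ; have [_ ->] := deg_le_iter_lt n dq.
  have [di _] := deg_le_iter_lt k dq.
  by rewrite skew_coefZ di ?mulr0 // ltn_add2r.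
move=> k; rewrite -mcoeff_neq0 ltnS leqNgt; apply: contraNN => nk.
by rewrite dp.
Qed.

Lemma deg_leU x n : deg_le n (<< x *g n >> : S).
Proof. by move=> k nk; rewrite mcoeffU ltn_eqF. Qed.

(** The terms [p_k t^(k+1)] of [t p] are exactly [p t]. *)
Lemma skew_commutator_coef p k :
  (skewt delta * p - p * skewt delta)@_k = delta p@_k.
Proof.
have -> : skewt delta * p = skew_lt p.
  by rewrite -[LHS]/(skew_mul _ _) skew_mulU /= scale1r.
have -> : p * skewt delta = \sum_(i <- msupp p) << p@_i *g i.+1 >>.
  rewrite -[LHS]/(skew_mul _ _); apply: eq_bigr => i _; apply: skewP => j.
  have -> : skewt delta = skew_lt (skewC delta 1) by rewrite skew_ltU.
  rewrite -iterSr skew_iter1 skew_scaleE !mcoeffU.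
  by rewrite mulrnAr mulr1.
rewrite /skew_lt big_split /= addrAC subrr add0r (@skew_coef_sum _ delta).
rewrite -[RHS](@skew_sum1 _ delta (fun i => delta p@_i) p k).
  by apply: eq_bigr => i _; rewrite mcoeffU.
by rewrite -mcoeff_neq0; apply: contraNneq => ->; rewrite raddf0.
Qed.

Lemma skew_mul_coef_in (b : set R) p q :
  ideal b -> invariant_set delta b ->
  (forall k, b q@_k) -> forall k, b (p * q)@_k.
Proof.
move=> ib invb bq k; have [b0 _ bM] := ib.
have biter i : forall j, b (iter i (@skew_lt _ delta) q)@_j.
  elim: i => //= i IH j; rewrite skew_ltE; apply: idealD => //.
    by case: j.
  by apply: invb; exists (iter i (@skew_lt _ delta) q)@_j.
rewrite -[p * q]/(skew_mul p q) skew_coef_sum.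
apply: (big_ind b) => // [x y|i _]; first exact: idealD.
by rewrite skew_scaleE; case: (bM p@_i _ (biter i k)).
Qed.

(** Using a bound [n] instead of the exact degree makes [0] a leading
    coefficient, and lets elements of different degrees be compared at a common
    bound. *)
Definition leading_coefs (I : set S) : set R :=
  [set c | exists n p, [/\ I p, deg_le n p & p@_n = c]].

Lemma leading_coefs_ideal (I : set S) : ideal I -> ideal (leading_coefs I).
Proof.
case=> I0 IB IM; split.
- by exists 0%N, 0; split=> // [k _|]; rewrite skew_coef0.
- move=> _ _ [n [p [Ip dp <-]]] [m [q [Iq dq <-]]].
  (* p t^m and q t^n have the same degree bound n + m *)
  have [dp' cp] := deg_leM dp (deg_leU 1 (n := m)).
  have [dq' cq] := deg_leM dq (deg_leU 1 (n := n)).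
  exists (n + m)%N, (p * << 1 *g m >> - q * << 1 *g n >>); split.
  + by apply: IB; [case: (IM << 1 *g m >> p Ip) | case: (IM << 1 *g n >> q Iq)].
  + by move=> k nk; rewrite skew_coefD skew_coefN dp' // dq' ?subrr // addnC.
  rewrite skew_coefD skew_coefN cp addnC cq !mcoeffU !eqxx.
  by rewrite !mulr1n !mulr1.
move=> r _ [n [p [Ip dp <-]]]; have [Il Ir] := IM (skewC delta r) p Ip.
split.
  exists n, (skewC delta r * p); split=> // [k nk|].
    by rewrite skewC_scale skew_coefZ dp ?mulr0.
  by rewrite skewC_scale skew_coefZ.
have [dp' cp] := deg_leM dp (deg_leU r (n := 0)).
exists (n + 0)%N, (p * skewC delta r); split=> //.
by rewrite cp mcoeffU eqxx mulr1n.
Qed.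

Lemma leading_coefs_invariant (I : set S) :
  ideal I -> invariant_set delta (leading_coefs I).
Proof.
case=> _ IB IM _ [_ [n [p [Ip dp <-]]] <-].
exists n, (skewt delta * p - p * skewt delta); split.
- by have [? ?] := IM (skewt delta) p Ip; apply: IB.
- by move=> k nk; rewrite skew_commutator_coef dp ?raddf0.
exact: skew_commutator_coef.
Qed.

(** If every leading coefficient of [p] at a valid bound vanishes, the bound can
    be lowered until nothing of [p] is left. *)
Lemma leading_coefs_neq0 (I : set S) p :
  I p -> p <> 0 -> leading_coefs I <> [set 0].
Proof.
move=> Ip p0 L0; apply: p0; have [n dp] := deg_leP p.
have lower m : deg_le m p -> p@_m = 0.
  move=> dm; have : leading_coefs I p@_m by exists m, p.
  by rewrite L0.
have d0 : deg_le 0 p.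
  elim: n dp => // n IH dp; apply: IH => k; rewrite leq_eqVlt => /orP[/eqP<-|].
    exact: lower.
  exact: dp.
by apply: skewP => -[|k]; rewrite skew_coef0; [apply: lower | apply: d0].
Qed.

Lemma leading_coefs_mul0 (I J : set S) :
  (forall p q, I p -> J q -> p * q = 0) ->
  forall x y, leading_coefs I x -> leading_coefs J y -> x * y = 0.
Proof.
move=> IJ _ _ [n [p [Ip dp <-]]] [m [q [Jq dq <-]]].
by have [_ <-] := deg_leM dp dq; rewrite IJ // skew_coef0.
Qed.

End SkewCoefficients.

(** * Transfer of gr-primeness *)

Section SkewGraded.
Variables (Gamma : groupType) (R : pzRingType) (G : grading Gamma R).
Variables (gamma : Gamma) (delta : derivation R).
Hypothesis gammaC : centralizer (gr_support G) gamma.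
Hypothesis deltaD : Der G gamma delta.
Local Notation SG := (skew_grading gammaC deltaD).

Lemma skew_gcomp_coef tau (p : skewpoly delta) n :
  (gcomp SG tau p)@_n = gcomp G (tau * gamma ^- n)%g p@_n.
Proof.
have [s ->] := gcomp_sum SG p.
rewrite raddf_sum !skew_coef_sum raddf_sum; apply: eq_bigr => rho _ /=.
have Gp := gcomp_in SG rho p.
rewrite (gcomp_homog _ Gp) (gcomp_homog _ (Gp n)).
by rewrite (inj_eq (@mulIg _ _)); case: eqP => // _; rewrite skew_coef0.
Qed.

(** The component of degree [sigma] of the coefficient of [t^n] in [p] is the
    coefficient of [t^n] in the component of [p] of degree [sigma gamma^n]. *)
Lemma leading_coefs_graded (I : set (skewpoly delta)) :
  graded_ideal SG I -> graded_ideal G (leading_coefs I).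
Proof.
move=> gI; have [iI _] := gI.
apply: gcomp_graded_ideal; first exact: leading_coefs_ideal.
move=> sigma _ [n [p [Ip dp <-]]].
exists n, (gcomp SG (sigma * gamma ^+ n)%g p); split.
- exact: graded_ideal_gcomp.
- by move=> k nk; rewrite skew_gcomp_coef dp ?raddf0.
by rewrite skew_gcomp_coef mulgK.
Qed.

Lemma skewC_homogeneous sigma x : G sigma x -> homogeneous SG (skewC delta x).
Proof.
move=> Gx; exists sigma => i; rewrite mcoeffU; case: eqP => [<-|_].
  by rewrite expg0 invg1 mulg1.
exact: gr_comp0.
Qed.

Lemma skewC_eq0 x : skewC delta x = 0 -> x = 0.
Proof.
move=> /(congr1 (fun p : skewpoly delta => p@_0%N)).
by rewrite skew_coef0 mcoeffU eqxx.
Qed.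

Lemma gr_prime_delta_gr_prime : gr_prime SG -> delta_gr_prime G delta.
Proof.
move=> prS a b ga inva gb invb ab0.
have [a0|/(graded_ideal_neq0 ga)] := pselect (a = [set 0]); first by left.
case=> sigma [x [ax Gx x0]].
have [b0|/(graded_ideal_neq0 gb)] := pselect (b = [set 0]); first by right.
case=> tau [y [by_ Gy y0]].
have [[[a0 _ _] _] [ib _]] := (ga, gb); have [b0 _ _] := ib.
have {}ab0 := (ideal_prod_eq0 a0 b0).1 ab0.
case: (prS _ _ (skewC_homogeneous Gx) (skewC_homogeneous Gy)).
- move=> r; apply: skewP => k.
  rewrite -mulrA skewC_scale skew_coefZ skew_coef0; apply: ab0 => //.
  apply: skew_mul_coef_in => // j; rewrite mcoeffU.
  by case: eqP => _; rewrite ?mulr0n ?mulr1n.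
- by move/skewC_eq0.
by move/skewC_eq0.
Qed.

Lemma delta_gr_prime_gr_prime : delta_gr_prime G delta -> gr_prime SG.
Proof.
move=> prR x y _ hy xSy.
have [->|x0] := pselect (x = 0); first by left.
have [->|y0] := pselect (y = 0); first by right.
pose I := left_annihilator y; pose J := right_annihilator I.
have gI : graded_ideal SG I := left_annihilator_graded hy.
have gJ : graded_ideal SG J := right_annihilator_graded gI.
have [[iI _] [iJ _]] := (gI, gJ).
have [gLI gLJ] := (leading_coefs_graded gI, leading_coefs_graded gJ).
have Jy : J y by move=> p Ip; rewrite -[p]mulr1 Ip.
have IJ p q : I p -> J q -> p * q = 0 by move=> Ip; apply.
have [[[LI0 _ _] _] [[LJ0 _ _] _]] := (gLI, gLJ).
case: (prR _ _ gLI (leading_coefs_invariant iI)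
               gLJ (leading_coefs_invariant iJ)).
- by apply/(ideal_prod_eq0 LI0 LJ0); apply: leading_coefs_mul0.
- by move/(leading_coefs_neq0 (xSy : I x)).
by move/(leading_coefs_neq0 Jy).
Qed.

End SkewGraded.

Theorem theorem1p6 (Gamma : groupType) (R : pzRingType) (G : grading Gamma R)
    (gamma : Gamma) (gammaC : centralizer (gr_support G) gamma)
    (delta : derivation R) (deltaD : Der G gamma delta) :
  gr_prime (skew_grading gammaC deltaD) <-> delta_gr_prime G delta.
Proof.
split; [exact: gr_prime_delta_gr_prime | exact: delta_gr_prime_gr_prime].
Qed.
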